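(* Let $n>1$ be an odd integer and $d$ a positive integer with $\gcd(n,d)=1$. Let $r$ be an integer with $n-(n-1)d/2\leq r\leq n$ and $n\equiv r\pmod d$. For integers $k\geq 0$ define $$c_q(k)=(-1)^k\frac{(1+q^{2dk+r})(q^{2r};q^{2d})^2_k}{(1+q^r)(q^{2d};q^{2d})^2_k}q^{dk^2+k(d-r)}.$$ Then, modulo $\Phi_n(-q)^2\Phi_n(q)^2$, $$\sum_{k=0}^{n-1}\sum_{j=0}^{k}c_q(j)c_q(k-j)\equiv \frac{[n]^2_{q^2}}{[r]^2_{q^2}}q^{\frac{2(n-r)(n+r-d)}{d}}\bigg(\sum_{k=0}^{\frac{n-r}{d}}\frac{(q^{2r},q^r;q^{2d})_k}{(q^{2d},q^{2d+r};q^{2d})_k}q^{2k(d-r)}\bigg)^2.$$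
   Context: Here $q$ is an indeterminate. The $q$-shifted factorial is $(a;q)_0=1$, $(a;q)_m=(1-a)(1-aq)\cdots(1-aq^{m-1})$ for $m\geq1$, and $(a_1,\dots,a_s;q)_m=(a_1;q)_m\cdots(a_s;q)_m$. The $q$-integer is $[m]_q=(1-q^m)/(1-q)$, so $[m]_{q^2}=(1-q^{2m})/(1-q^2)$. $\Phi_n(q)$ denotes the $n$-th cyclotomic polynomial in $q$. A congruence between rational functions in $q$ modulo a polynomial $P(q)$ means that the numerator of the difference (in reduced form) is divisible by $P(q)$ while its denominator is coprime to $P(q)$. *)

(* Defs.v *)
From mathcomp Require Import all_boot all_order all_algebra all_field.

Set Implicit Arguments.
Unset Strict Implicit.
Unset Printing Implicit Defensive.

Import GRing.Theory Num.Theory.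
Local Open Scope ring_scope.

Notation "x %:F" := (@FracField.tofrac _ x) : ring_scope.
Notation ratfun := {fraction {poly rat}}.

Definition q : ratfun := ('X : {poly rat})%:F.

Section QNotation.

Variable F : fieldType.

Definition qpoch (a b : F) (m : nat) : F := \prod_(i < m) (1 - a * b ^+ i).

Definition qint (b : F) (m : int) : F := (1 - b ^ m) / (1 - b).

End QNotation.

Definition Phi (n : nat) : {poly rat} := map_poly intr 'Phi_n.

Definition Phi_opp (n : nat) : {poly rat} := Phi n \Po (- 'X).

(* [u / v] below is the reduced form of [A - B]; it is unique up to a nonzero
   scalar, so the choice of [u] and [v] does not matter. *)
Definition eqmod_ratfun (P : {poly rat}) (A B : ratfun) : Prop :=
  exists u v : {poly rat},
    [/\ v != 0, coprimep u v, A - B = u%:F / v%:F, P %| u & coprimep v P].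

Definition c (d : nat) (r : int) (k : nat) : ratfun :=
  (-1) ^+ k
  * ((1 + q ^ ((2 * d * k)%:Z + r)) * qpoch (q ^ (2 * r)) (q ^+ (2 * d)) k ^+ 2)
  / ((1 + q ^ r) * qpoch (q ^+ (2 * d)) (q ^+ (2 * d)) k ^+ 2)
  * q ^ ((d * k ^ 2)%:Z + k%:Z * (d%:Z - r)).

(* Main.v *)
Require Import Defs.
From mathcomp Require Import all_boot all_order all_algebra all_field.
From mathcomp Require Import ring zify.

(* Put p = q^(2d), x = q^r, y = q^(2n) and m = (n - r)/d, so that x^2 = y p^-m
   and 1 - y is divisible by P = Phi_n(q) Phi_n(-q). Modulo (1 - y)^2 one may
   replace (x^2; p)_k^2 by (x^2/y, x^2 y; p)_k and (p; p)_k^2 by (p y, p/y; p)_k,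
   which turns the truncated sum S of c_q(k) over k <= m into a terminating
   very-well-poised series. A limiting case of Watson's transformation rewrites
   it as a 3phi2 series times (x^2 p; p)_m / (p/y; p)_m; this factor contains
   1 - y, which absorbs the only possibly singular denominator 1 - q^n, and
   undoing the replacement gives the sum on the right-hand side.
   For m > 0 the terms c_q(k) with m < k < n vanish modulo P^2, and 2m < n, so
   the double sum is S^2. For m = 0 the terms with k > 0 vanish only modulo
   Phi_n(q)^2 Phi_n(-q), and the missing factor Phi_n(-q) of their sum comes from
   the antisymmetry k -> n - k. *)

Set Implicit Arguments.
Unset Strict Implicit.
Unset Printing Implicit Defensive.

Import GRing.Theory Num.Theory.
Local Open Scope ring_scope.

(** * Basic hypergeometric identities *)

Section QSeries.
Variable F : fieldType.
Implicit Types (a b c f p x y : F).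

Lemma qpoch0 a p : qpoch a p 0 = 1.
Proof. by rewrite /qpoch big_ord0. Qed.

Lemma qpochS a p k : qpoch a p k.+1 = qpoch a p k * (1 - a * p ^+ k).
Proof. by rewrite /qpoch big_ord_recr. Qed.

Lemma qpochD a p k i : qpoch a p (k + i) = qpoch a p k * qpoch (a * p ^+ k) p i.
Proof.
rewrite /qpoch big_split_ord /=; congr (_ * _); apply: eq_bigr => j _.
by rewrite exprD mulrA.
Qed.

Lemma qpochSl a p k : qpoch a p k.+1 = (1 - a) * qpoch (a * p) p k.
Proof. by rewrite -add1n qpochD qpochS qpoch0 expr0 mulr1 mul1r expr1. Qed.

Lemma qpoch_neq0 a p k :
  (forall i, (i < k)%N -> a * p ^+ i != 1) -> qpoch a p k != 0.
Proof.
by move=> h; apply/prodf_neq0 => i _; rewrite subr_eq0 eq_sym h.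
Qed.

(* [(p^-N; p)_i * p^(N i)], without negative powers. *)
Definition rfac p (N i : nat) : F := \prod_(l < i) (p ^+ N - p ^+ l).

Lemma rfac0 p N : rfac p N 0 = 1.
Proof. by rewrite /rfac big_ord0. Qed.

Lemma rfacS p N i : rfac p N i.+1 = rfac p N i * (p ^+ N - p ^+ i).
Proof. by rewrite /rfac big_ord_recr. Qed.

Lemma rfac_small p N i : (N < i)%N -> rfac p N i = 0.
Proof.
move=> ltNi; apply/eqP/prodf_eq0; exists (Ordinal ltNi) => //.
by rewrite subrr.
Qed.

(** Every factor after the first is [p] times a factor of [rfac p N i]. This feeds the Pascal rule
    in [q_Vandermonde]. *)
Lemma rfac_pow p N i : rfac p N.+1 i.+1 = (p ^+ N.+1 - 1) * p ^+ i * rfac p N i.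
Proof.
rewrite /rfac big_ord_recl /= expr0 -mulrA; congr (_ * _).
rewrite -[in p ^+ i](card_ord i) -prodr_const -big_split /=.
by apply: eq_bigr => l _; rewrite mulrBr -!exprS.
Qed.

Lemma rfac_shift p N k i :
  rfac p (k + N) (k + i) = rfac p (k + N) k * p ^+ (k * i) * rfac p N i.
Proof.
rewrite {1}/rfac big_split_ord /= -mulrA; congr (_ * _).
rewrite exprM -[in _ ^+ i](card_ord i) -prodr_const -big_split /=.
by apply: eq_bigr => l _; rewrite mulrBr -!exprD.
Qed.

(** Induction on [k]: the last factor p^(k+i+1) - p^k equals -p^k (1 - p^(i+1)), which [qpoch p p i]
    absorbs. *)
Lemma rfac_qpoch p k i :
  rfac p (k + i) k * qpoch p p i
  = (-1) ^+ k * p ^+ 'C(k, 2) * qpoch p p (k + i).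
Proof.
elim: k i => [|k IHk] i.
  by rewrite rfac0 add0n bin_small // !expr0 !mul1r.
rewrite rfacS -[(k.+1 + i)%N]addnS -mulrA.
have -> : (p ^+ (k + i.+1) - p ^+ k) * qpoch p p i = - p ^+ k * qpoch p p i.+1.
  by rewrite qpochS exprD -exprS; ring.
rewrite mulrCA IHk binS bin1 exprD exprS; ring.
Qed.

(** The q-Chu-Vandermonde sum 2phi1(p^-N, b; c; p, c p^N / b). Induction on [N] for all [c] at once:
    a Pascal rule splits each summand, and regrouping neighbours gives the sum for [N] with [c * p]
    in place of [c]. *)
Lemma q_Vandermonde p b c N :
    b != 0 -> (forall i, (i < N)%N -> p ^+ i.+1 != 1) ->
    (forall i, (i < N)%N -> c * p ^+ i != 1) ->
  \sum_(i < N.+1) rfac p N i * qpoch b p i / (qpoch p p i * qpoch c p i)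
     * (c / b) ^+ i
  = qpoch (c / b) p N / qpoch c p N.
Proof.
move=> b0; elim: N c => [|N IHN] c hp hc.
  by rewrite big_ord_recl big_ord0 rfac0 !qpoch0 expr0 !mulr1 invr1 mulr1 addr0.
have hpS k : (k <= N.+1)%N -> qpoch p p k != 0.
  move=> lek; apply: qpoch_neq0 => i lti; rewrite -exprS.
  by apply: hp; apply: leq_trans lti lek.
have hcS k : (k <= N.+1)%N -> qpoch c p k != 0.
  by move=> lek; apply: qpoch_neq0 => i lti; apply/hc/(leq_trans lti).
have c1 : 1 - c != 0 by rewrite subr_eq0 eq_sym -[c]mulr1 -(expr0 p) hc.
pose g i := qpoch b p i / (qpoch p p i * qpoch c p i) * (c / b) ^+ i.
have Pascal i : (i <= N)%N ->
    rfac p N.+1 i.+1 * g i.+1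
    = p ^+ i.+1 * rfac p N i.+1 * g i.+1
      - p ^+ i * (1 - b * p ^+ i) / (1 - c * p ^+ i) * (c / b) * (rfac p N i * g i).
  move=> leiN; rewrite rfac_pow rfacS /g !(qpochS _ _ i) !exprSr.
  have := hpS i (leqW leiN); have := hcS i (leqW leiN).
  have: 1 - c * p ^+ i != 0 by rewrite subr_eq0 eq_sym hc.
  have: 1 - p * p ^+ i != 0 by rewrite subr_eq0 eq_sym -exprS hp.
  by move=> h1 h2 h3 h4; field; rewrite b0 h1 h2 h3 h4.
have shift i : (i <= N)%N ->
    p ^+ i * (rfac p N i * g i)
     - p ^+ i * (1 - b * p ^+ i) / (1 - c * p ^+ i) * (c / b) * (rfac p N i * g i)
    = (1 - c / b) / (1 - c) * (rfac p N i * qpoch b p i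
        / (qpoch p p i * qpoch (c * p) p i) * (c * p / b) ^+ i).
  move=> leiN.
  have e : qpoch c p i * (1 - c * p ^+ i) = (1 - c) * qpoch (c * p) p i.
    by rewrite -qpochS qpochSl.
  have h2 := hpS i (leqW leiN); have h3 := hcS i (leqW leiN).
  have h1 : 1 - c * p ^+ i != 0 by rewrite subr_eq0 eq_sym hc.
  have h4 : qpoch (c * p) p i != 0.
    by have := hcS i.+1 leiN; rewrite qpochSl mulf_eq0 negb_or => /andP[].
  have -> : qpoch (c * p) p i = qpoch c p i * (1 - c * p ^+ i) / (1 - c).
    by rewrite e; field.
  have -> : (c * p / b) ^+ i = p ^+ i * (c / b) ^+ i.
    by rewrite -exprMn; congr (_ ^+ _); ring.
  by rewrite /g; field; rewrite b0 h1 h2 h3 c1.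
rewrite qpochSl (qpochSl c).
have -> : (1 - c / b) * qpoch (c / b * p) p N / ((1 - c) * qpoch (c * p) p N)
   = (1 - c / b) / (1 - c) * (qpoch (c * p / b) p N / qpoch (c * p) p N).
  by rewrite invfM (mulrAC c); ring.
rewrite -IHN; last 2 first.
- by move=> i lti; apply: hp; apply: leqW.
- by move=> i lti; rewrite -mulrA -exprS; apply: hc.
pose u i := p ^+ i * (rfac p N i * g i).
pose v i := p ^+ i * (1 - b * p ^+ i) / (1 - c * p ^+ i) * (c / b) * (rfac p N i * g i).
(* Shifting the index pairs [u i] with [v i]; the boundary term [u N.+1] is zero because
   [rfac p N N.+1] is. *)
transitivity (u 0%N + \sum_(i < N.+1) (u i.+1 - v i)).
  rewrite big_ord_recl; congr (_ + _).
    by rewrite /u /g !rfac0 expr0 !mul1r.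
  apply: eq_bigr => i _; rewrite lift0.
  transitivity (rfac p N.+1 i.+1 * g i.+1); first by rewrite /g !mulrA.
  by rewrite Pascal ?leq_ord // /u /v !mulrA.
rewrite sumrB addrA -[u 0%N]/(u (@ord0 N.+1)) -(big_ord_recl _ (fun i => u i)).
rewrite big_ord_recr /= [u N.+1]/u rfac_small // mul0r mulr0 addr0 -sumrB.
by rewrite mulr_sumr; apply: eq_bigr => i _; rewrite shift ?leq_ord.
Qed.

(** The terminating very-well-poised 6phi5 sum with one parameter equal to [p], a case in which the
    summand is a difference of consecutive values of a closed form. *)
Lemma telescoping_sum p a f j :
    a != 0 -> f != 0 -> (forall i, a * p ^+ i.+1 != 1) ->
    (forall i, a / f * p ^+ i.+1 != 1) -> a / f * p ^+ j != 1 ->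
  \sum_(k < j.+1) (1 - a * p ^+ (2 * k)) * (rfac p j k / qpoch (a * p ^+ j.+1) p k)
     * (qpoch f p k / qpoch (a / f * p) p k * (a / f) ^+ k)
  = (1 - a * p ^+ j) * (1 - a / f) / (1 - a / f * p ^+ j).
Proof.
move=> a0 f0 ha hf hj.
have H1 k : qpoch (a * p ^+ j.+1) p k != 0.
  by apply: qpoch_neq0 => i _; rewrite -mulrA -exprD addSn.
have H2 k : qpoch (a / f * p) p k != 0.
  by apply: qpoch_neq0 => i _; rewrite -mulrA -exprS.
have zj : 1 - a / f * p ^+ j != 0 by rewrite subr_eq0 eq_sym.
(* The difference [t k - t k.+1] is the summand because (1 - a p^(j+k)) (1 - (a/f) p^k) - (a/f) (p^j
   - p^k) (1 - f p^k) = (1 - a p^(2k)) (1 - (a/f) p^j). *)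
pose t k := rfac p j k / qpoch (a * p ^+ j.+1) p k
   * (qpoch f p k / qpoch (a / f * p) p k * (a / f) ^+ k)
   * (1 - a * p ^+ (j + k)) * (1 - a / f * p ^+ k) / (1 - a / f * p ^+ j).
transitivity (\sum_(0 <= k < j.+1) (t k - t k.+1)).
  rewrite big_mkord; apply: eq_bigr => k _; move: {k}(k : nat) => k.
  have := H1 k.+1; have := H2 k.+1.
  rewrite /t rfacS !(qpochS _ _ k) !mulf_eq0 !negb_or addnS.
  rewrite -[a / f * p * _]mulrA -exprS -[a * p ^+ j.+1 * _]mulrA -exprD addSn.
  move=> /andP[B0 hB] /andP[A0 hA]; rewrite (exprSr (a / f)).
  move: (qpoch _ _ _) A0 (qpoch _ _ _) B0 (qpoch f p k) => A A0 B B0 C.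
  move: (rfac p j k) ((a / f) ^+ k) => R Z.
  move: hA hB; set u := 1 - _ => hA; set v := 1 - _ => hB.
  rewrite [RHS](_ : _ = R / A * (C / B * Z)
     * (((1 - a * p ^+ (j + k)) * (1 - a / f * p ^+ k)
         - a / f * (p ^+ j - p ^+ k) * (1 - f * p ^+ k)) / (1 - a / f * p ^+ j)));
    last first.
    by move: zj; set w := 1 - a / f * p ^+ j => zj; field; rewrite A0 hA B0 hB zj f0.
  rewrite -mulrA mulrC; congr (_ * _); apply: (mulIf zj); rewrite divfK //.
  by rewrite mul2n -addnn !exprD; field.
rewrite -[LHS]opprK -sumrN (eq_bigr (fun k => t k.+1 - t k)) => [|k _]; last by rewrite opprB.
rewrite telescope_sumr // opprB /t (rfac_small p (ltnSn j)) rfac0 !qpoch0 addn0 !expr0.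
by rewrite !mul0r subr0 !invr1 !mulr1 mul1r.
Qed.

(* The terminating 8phi7-to-4phi3 transformation of Watson with one parameter
   equal to [p] and another one sent to infinity: expanding the [c]-dependent
   factor by the q-Vandermonde sum leaves an inner sum that telescopes. *)
Lemma Watson_limit p a c f m :
    p != 0 -> a != 0 -> c != 0 -> f != 0 ->
    (forall i, p ^+ i.+1 != 1) -> (forall i, a * p ^+ i.+1 != 1) ->
    (forall i, a / f * p ^+ i != 1) ->
    (forall i, (i < m)%N -> a / c * p ^+ i.+1 != 1) ->
  \sum_(k < m.+1) (1 - a * p ^+ (2 * k))
     * (qpoch f p k / qpoch (a / f * p) p k * (a / f) ^+ k)
     * (rfac p m k * qpoch c p k / (qpoch (a * p ^+ m.+1) p k * qpoch (a / c * p) p k)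
        * ((-1) ^+ k * p ^+ 'C(k, 2) * (a / c * p) ^+ k))
  = qpoch (a * p) p m / qpoch (a / c * p) p m
    * \sum_(j < m.+1) rfac p m j * qpoch c p j / (qpoch p p j * qpoch (a * p) p j)
        * (a / c * p) ^+ j
        * ((1 - a * p ^+ j) * (1 - a / f) / (1 - a / f * p ^+ j)).
Proof.
move=> p0 a0 c0 f0 hp ha hf hc.
have P0 k : qpoch p p k != 0.
  by apply: qpoch_neq0 => i _; rewrite -exprS.
have A0 l k : qpoch (a * p ^+ l.+1) p k != 0.
  by apply: qpoch_neq0 => i _; rewrite -mulrA -exprD addSn.
have C0 k : (k <= m)%N -> qpoch (a / c * p) p k != 0.
  move=> lek; apply: qpoch_neq0 => i lti; rewrite -mulrA -exprS hc //.
  exact: leq_trans lti lek.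
pose G j := rfac p m j * qpoch c p j / (qpoch p p j * qpoch (a * p) p j)
        * (a / c * p) ^+ j.
have expand k : (k <= m)%N ->
    rfac p m k * qpoch c p k / (qpoch (a * p ^+ m.+1) p k * qpoch (a / c * p) p k)
        * ((-1) ^+ k * p ^+ 'C(k, 2) * (a / c * p) ^+ k)
    = qpoch (a * p) p m / qpoch (a / c * p) p m
      * \sum_(j < m.+1) G j * (rfac p j k / qpoch (a * p ^+ j.+1) p k).
  move=> lekm; have [N mE] : exists N, m = (k + N)%N.
    by exists (m - k)%N; rewrite subnKC.
  rewrite -(big_mkord xpredT (fun j => G j * (rfac p j k / qpoch (a * p ^+ j.+1) p k))).
  (* Terms with j < k vanish. Put j = k + i: the rest is a q-Vandermonde sum of length N = m - k
     with parameters c p^k and a p^(2k+1). *)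
  rewrite (big_cat_nat _ (leqW lekm)) //= big_nat_cond big1 ?add0r; last first.
    by move=> j /andP[/andP[_ ltjk] _]; rewrite rfac_small // mul0r mulr0.
  rewrite -[X in \sum_(X <= _ < _) _]add0n big_addn subSn // big_mkord.
  rewrite mE addKn.
  pose W := c * p ^+ k.
  have W0 : W != 0 by rewrite mulf_neq0 // expf_neq0.
  have := @q_Vandermonde p W (a * p ^+ (2 * k).+1) N W0 (fun i _ => hp i).
  have -> : a * p ^+ (2 * k).+1 / W = a / c * p * p ^+ k.
    rewrite /W mul2n -addnn exprS exprD; field.
    by rewrite c0 expf_neq0.
  move=> V; rewrite (eq_bigr (fun i : 'I_N.+1 =>
    rfac p m k * qpoch c p k * ((-1) ^+ k * p ^+ 'C(k, 2) * (a / c * p) ^+ k)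
     / qpoch (a * p) p (2 * k) *
     (rfac p N i * qpoch W p i / (qpoch p p i * qpoch (a * p ^+ (2 * k).+1) p i)
      * (a / c * p * p ^+ k) ^+ i))) => [|i _]; last first.
    move: {i}(i : nat) => i.
    have E1 : qpoch (a * p) p (i + k) * qpoch (a * p ^+ (i + k).+1) p k
        = qpoch (a * p) p (2 * k) * qpoch (a * p ^+ (2 * k).+1) p i.
      rewrite !exprS !mulrA -!qpochD; congr qpoch; lia.
    have E2 : rfac p (i + k) k
        = (-1) ^+ k * p ^+ 'C(k, 2) * qpoch p p (i + k) / qpoch p p i.
      by rewrite [(i + k)%N]addnC -rfac_qpoch mulfK.
    have H1 := P0 i; have H2 := P0 (i + k)%N; have H3 := A0 0%N (i + k)%N.
    have H4 := A0 (i + k)%N k; have H5 := A0 (2 * k)%N i.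
    have H6 := A0 0%N (2 * k)%N; rewrite expr1 in H3 H6.
    have E3 : qpoch (a * p ^+ (2 * k).+1) p i
        = qpoch (a * p) p (i + k) * qpoch (a * p ^+ (i + k).+1) p k
          / qpoch (a * p) p (2 * k) by rewrite E1; field.
    rewrite /G E2 E3 [(i + k)%N]addnC mE rfac_shift qpochD (exprMn i).
    rewrite [(_ * p) ^+ (k + i)]exprD -/W -exprM.
    rewrite [(k + i)%N]addnC.
    move: (qpoch p p i) H1 (qpoch p p _) H2 (qpoch _ _ _) H3 => B1 H1 B2 H2 B3 H3.
    by field; rewrite H1 H2 H3 H4 H6.
  rewrite -mulr_sumr V; last by move=> i _; rewrite -mulrA -exprD addSn.
  have E1 : qpoch (a * p) p (k + N) * qpoch (a * p ^+ (k + N).+1) p k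
      = qpoch (a * p) p (2 * k) * qpoch (a * p ^+ (2 * k).+1) p N.
    rewrite !exprS !mulrA -!qpochD; congr qpoch; lia.
  have H1 := A0 0%N (k + N)%N; have H2 := A0 (k + N)%N k.
  have H3 := A0 0%N (2 * k)%N; have H4 := A0 (2 * k)%N N.
  have := C0 (k + N)%N; rewrite mE leqnn => /(_ isT); rewrite qpochD mulf_eq0 negb_or.
  rewrite expr1 in H1 H3; move=> /andP[H5 H6].
  have -> : qpoch (a * p ^+ (k + N).+1) p k = qpoch (a * p) p (2 * k)
      * qpoch (a * p ^+ (2 * k).+1) p N / qpoch (a * p) p (k + N).
    by rewrite -E1; field.
  by field; rewrite H1 H3 H4 H5 H6.
under eq_bigr => k _ do rewrite expand ?leq_ord // mulrCA mulr_sumr.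
(* After the exchange the inner sum over k stops at j, since [rfac p j k] vanishes beyond it, and
   [telescoping_sum] evaluates it. *)
rewrite -mulr_sumr exchange_big /=; congr (_ * _); apply: eq_bigr => j _.
rewrite -/(G j) -telescoping_sum // mulr_sumr.
rewrite (big_ord_widen_cond m.+1 xpredT (fun k => G j *
  ((1 - a * p ^+ (2 * k)) * (rfac p j k / qpoch (a * p ^+ j.+1) p k)
   * (qpoch f p k / qpoch (a / f * p) p k * (a / f) ^+ k)))) ?ltn_ord //.
rewrite [LHS](bigID (fun k : 'I_m.+1 => k < j.+1)%N) /= [X in _ + X]big1 ?addr0.
  by apply: eq_bigr => k _; ring.
by move=> k; rewrite -leqNgt => ltjk; rewrite rfac_small //; ring.
Qed.

Lemma rfac_qpochV p N k : p != 0 ->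
  rfac p N k = qpoch (p ^- N) p k * (p ^+ N) ^+ k.
Proof.
move=> p0; rewrite /rfac /qpoch -[in _ ^+ k](card_ord k) -prodr_const -big_split.
by apply: eq_bigr => l _ /=; rewrite mulrBl mul1r mulrAC mulVf ?mul1r ?expf_neq0.
Qed.

Lemma deformed_sum p x y m :
    p != 0 -> x != 0 -> y = x ^+ 2 * p ^+ m ->
    (forall i, p ^+ i.+1 != 1) -> (forall i, x ^+ 2 * p ^+ i != 1) ->
    (forall i, (i < m)%N -> y^-1 * p ^+ i.+1 != 1) ->
  \sum_(k < m.+1) (1 + x * p ^+ k) / (1 + x)
     * (qpoch (x ^+ 2 / y) p k * qpoch (x ^+ 2 * y) p k
        / (qpoch (p * y) p k * qpoch (p / y) p k))
     * ((-1) ^+ k * p ^+ 'C(k, 2) * (p / x) ^+ k)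
  = qpoch (x ^+ 2 * p) p m / qpoch (p / y) p m
    * \sum_(j < m.+1) qpoch (x ^+ 2 / y) p j * qpoch (x ^+ 2 * y) p j
        / (qpoch p p j * qpoch (x ^+ 2) p j)
        * ((1 - x) / (1 - x * p ^+ j)) * (p / x ^+ 2) ^+ j.
Proof.
move=> p0 x0 yE hp ha hy; set a := x ^+ 2.
have a0 : a != 0 by rewrite expf_neq0.
have y0 : y != 0 by rewrite yE mulf_neq0 ?expf_neq0.
have hx i : x * p ^+ i != 1.
  apply: contraNneq (ha (i + i)%N) => e.
  by rewrite exprD expr2 mulrACA e mulr1.
have ayE : a / y = p ^- m by rewrite yE -/a invfM mulrA divff ?mul1r.
have axE : a / x = x by rewrite /a expr2 mulfK.
have x1 : 1 - x != 0 by rewrite subr_eq0 eq_sym -[x]mulr1 -(expr0 p).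
have a1 : 1 - a != 0 by rewrite subr_eq0 eq_sym -[a]mulr1 -(expr0 p).
have x1' : 1 + x != 0.
  by apply: contraNneq a1 => e; rewrite /a -[1](expr1n _ 2) subr_sqr e mulr0.
have c0 : a * y != 0 by rewrite mulf_neq0.
have acE : a / (a * y) = y^-1 by rewrite invfM mulrA divff ?mul1r.
(* With c = a y and f = x one gets a / f = x, a / c = 1 / y and a p^(m+1) = p y, while a / y = p^-m
   turns [rfac p m k] into (a / y; p)_k times a power. *)
have := @Watson_limit p a (a * y) x m p0 a0 c0 x0 hp (fun i => ha i.+1).
rewrite axE acE => /(_ hx hy) W.
have H1 k : qpoch x p k * (1 - x * p ^+ k) = (1 - x) * qpoch (x * p) p k.
  by rewrite -qpochS qpochSl.
have H2 k : qpoch a p k * (1 - a * p ^+ k) = (1 - a) * qpoch (a * p) p k.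
  by rewrite -qpochS qpochSl.
have xp0 i : 1 - x * p ^+ i != 0 by rewrite subr_eq0 eq_sym.
have ap0 i : 1 - a * p ^+ i != 0 by rewrite subr_eq0 eq_sym ha.
have Q1 k : qpoch (x * p) p k != 0.
  by apply: qpoch_neq0 => i _; rewrite -mulrA -exprS.
have Q2 k : qpoch a p k != 0 by apply: qpoch_neq0.
have Q3 k : qpoch (a * p) p k != 0.
  by apply: qpoch_neq0 => i _; rewrite -mulrA -exprS.
have Q4 k : qpoch p p k != 0.
  by apply: qpoch_neq0 => i _; rewrite -exprS.
have Q5 k : (k <= m)%N -> qpoch (p / y) p k != 0.
  move=> lekm; apply: qpoch_neq0 => i lti; rewrite mulrAC -exprS mulrC hy //.
  exact: leq_trans lti lekm.
have yap : a * p ^+ m.+1 = p * y by rewrite yE exprS /a; ring.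
have ypm : p ^+ m = y / a by rewrite yE -/a; field.
have e1 : y^-1 * p = p / y by rewrite mulrC.
rewrite yap e1 in W.
(* After multiplication by (1 - x) (1 + x) the left side is the Watson sum: 1 - x^2 p^(2k) = (1 - x
   p^k) (1 + x p^k) and (x; p)_k / (x p; p)_k = (1 - x) / (1 - x p^k). *)
apply: (mulfI (mulf_neq0 x1 x1')); rewrite [RHS]mulrCA.
transitivity (\sum_(k < m.+1) (1 - a * p ^+ (2 * k))
   * (qpoch x p k / qpoch (x * p) p k * x ^+ k)
   * (rfac p m k * qpoch (a * y) p k / (qpoch (p * y) p k * qpoch (p / y) p k)
      * ((-1) ^+ k * p ^+ 'C(k, 2) * (p / y) ^+ k))).
  rewrite mulr_sumr; apply: eq_bigr => k _; move: {k}(k : nat) (leq_ord k) => k lek.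
  rewrite rfac_qpochV // -ayE ypm.
  have -> : qpoch x p k = (1 - x) * qpoch (x * p) p k / (1 - x * p ^+ k).
    by rewrite -H1 mulfK.
  have -> : (p / x) ^+ k = x ^+ k * (y / a) ^+ k * (p / y) ^+ k.
    by rewrite -!exprMn; congr (_ ^+ _); rewrite /a; field; rewrite x0 y0.
  have -> : 1 - a * p ^+ (2 * k) = (1 - x * p ^+ k) * (1 + x * p ^+ k).
    by rewrite mulnC exprM /a; ring.
  rewrite (invfM (qpoch (p * y) p k)).
  move: (qpoch (p * y) p k)^-1 (qpoch (p / y) p k)^-1 (qpoch (x * p) p k) (Q1 k) (xp0 k).
  move: (p ^+ k) => X A B C C0 D0.
  by field; rewrite x1' C0 D0.
rewrite W; congr (_ * _); rewrite mulr_sumr; apply: eq_bigr => j _.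
move: {j}(j : nat) (leq_ord j) => j lej.
rewrite rfac_qpochV // -ayE ypm.
have -> : qpoch (a * p) p j = qpoch a p j * (1 - a * p ^+ j) / (1 - a).
  by rewrite H2; field.
have -> : (p / a) ^+ j = (y / a) ^+ j * (p / y) ^+ j.
  by rewrite -!exprMn; congr (_ ^+ _); field; rewrite a0 y0.
have aE : 1 - a = (1 - x) * (1 + x) by rewrite /a; ring.
have := a1; rewrite aE => a1'.
move: (qpoch p p j) (Q4 j) (qpoch a p j) (Q2 j) (xp0 j) (ap0 j) => B B0 C C0.
move: (p ^+ j) => X D0 E0.
by field; rewrite B0 C0 D0 E0 x1' x1.
Qed.

(** Reversal of the product. For a = x^2 the new base point is p / y, so (x^2; p)_m cancels against
    (p / y; p)_m. *)
Lemma qpoch_flip p a m : p != 0 -> a != 0 ->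
  qpoch a p m = (- a) ^+ m * p ^+ 'C(m, 2) * qpoch (p / (a * p ^+ m)) p m.
Proof.
move=> p0; elim: m a => [|m IHm] a a0.
  by rewrite !qpoch0 bin_small // !expr0 !mulr1.
have pm0 : p ^+ m != 0 by rewrite expf_neq0.
rewrite qpochSl IHm ?mulf_neq0 // -[a * p * _]mulrA -exprS qpochS binS bin1 exprD.
rewrite -mulNr exprMn [(- a) ^+ m.+1]exprSr exprS.
by field; rewrite a0 p0 pm0.
Qed.
End QSeries.

(** * Congruences over a subring of a field *)

(** The inner sums are the coefficients of g^2 for the polynomial g with coefficients [f 0], ...,
    [f m]. Its degree is at most 2m < N, so all of them occur and add up to g(1)^2. *)
Lemma double_sum_square (R : comNzRingType) (f : nat -> R) m N : (2 * m < N)%N ->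
  \sum_(k < N) \sum_(j < k.+1)
     (if (j < m.+1)%N then f j else 0) * (if (k - j < m.+1)%N then f (k - j)%N else 0)
  = (\sum_(k < m.+1) f k) ^+ 2.
Proof.
move=> lemN; pose g := \poly_(i < m.+1) f i.
have -> : \sum_(k < m.+1) f k = g.[1].
  by rewrite horner_poly; apply: eq_bigr => k _; rewrite expr1n mulr1.
have sg : (size (g * g)%R <= N)%N.
  have := size_polyMleq g g; have := size_poly m.+1 f; rewrite -/g; lia.
rewrite expr2 -hornerM (horner_coef_wide _ sg); apply: eq_bigr => k _.
rewrite expr1n mulr1 coefM; apply: eq_bigr => j _.
by rewrite !coef_poly.
Qed.

Lemma double_bin2 N : (2 * 'C(N.+1, 2) = N.+1 * N)%N.
Proof. by elim: N => [|N IHN] //; rewrite binS bin1 mulnDr IHN; lia. Qed.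

Section Congruence.
Variables (F : fieldType) (integral : F -> Prop).
Hypotheses (integral1 : integral 1)
  (integralB : forall A B, integral A -> integral B -> integral (A - B))
  (integralM : forall A B, integral A -> integral B -> integral (A * B)).
Implicit Types (A B C D a b : F).

Lemma integral0 : integral 0.
Proof. by rewrite -(subrr 1); apply: integralB. Qed.

Lemma integralN A : integral A -> integral (- A).
Proof. by move=> iA; rewrite -sub0r; apply/integralB/iA/integral0. Qed.

Lemma integralD A B : integral A -> integral B -> integral (A + B).
Proof. by move=> iA iB; rewrite -[B]opprK; apply/integralB/integralN. Qed.

Lemma integralX A k : integral A -> integral (A ^+ k).
Proof.
move=> iA; elim: k => [|k IHk]; first exact: integral1.
by rewrite exprS; apply: integralM.
Qed.

Lemma integral_sum (I : eqType) (s : seq I) (h : I -> F) :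
  (forall i, i \in s -> integral (h i)) -> integral (\sum_(i <- s) h i).
Proof.
move=> ih; rewrite big_seq; by elim/big_ind: _ => //; [exact: integral0 | exact: integralD].
Qed.

Lemma integral_prod (I : eqType) (s : seq I) (h : I -> F) :
  (forall i, i \in s -> integral (h i)) -> integral (\prod_(i <- s) h i).
Proof.
move=> ih; rewrite big_seq; by elim/big_ind: _.
Qed.

Lemma integral_qpoch a b k : integral a -> integral b -> integral (qpoch a b k).
Proof.
move=> ia ib; apply: integral_prod => i _; apply: integralB integral1 _.
exact/integralM/integralX.
Qed.

Lemma integral_qpochV a b k :
    (forall i, (i < k)%N -> integral (1 - a * b ^+ i)^-1) ->
  integral (qpoch a b k)^-1.
Proof.
move=> h; rewrite /qpoch -prodfV; apply: integral_prod => i _; exact: h.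
Qed.

(** Only the difference is constrained: [A] and [B] may lie outside the subring, and the rules for
    products ask for integrality where it matters. *)
Definition cong D A B := exists2 z, integral z & A - B = D * z.

Lemma congxx D A : cong D A A.
Proof. by exists 0; rewrite ?mulr0 ?subrr //; apply: integral0. Qed.

Lemma cong_sym D A B : cong D A B -> cong D B A.
Proof.
by move=> [z iz e]; exists (- z); rewrite ?mulrN -?e ?opprB //; apply: integralN.
Qed.

Lemma cong_trans D B A C : cong D A B -> cong D B C -> cong D A C.
Proof.
move=> [z iz e] [z' iz' e']; exists (z + z'); first exact: integralD.
by rewrite mulrDr -e -e' addrA subrK.
Qed.

Lemma congD D A B A' B' : cong D A B -> cong D A' B' -> cong D (A + A') (B + B').
Proof.
move=> [z iz e] [z' iz' e']; exists (z + z'); first exact: integralD.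
by rewrite mulrDr -e -e'; ring.
Qed.

Lemma congN D A B : cong D A B -> cong D (- A) (- B).
Proof.
move=> [z iz e]; exists (- z); first exact: integralN.
by rewrite mulrN -e; ring.
Qed.

Lemma congMl D C A B : integral C -> cong D A B -> cong D (C * A) (C * B).
Proof.
move=> iC [z iz e]; exists (C * z); first exact: integralM.
by rewrite mulrCA -e; ring.
Qed.

Lemma congMr D C A B : integral C -> cong D A B -> cong D (A * C) (B * C).
Proof. by rewrite ![_ * C]mulrC; apply: congMl. Qed.

Lemma congM D A B A' B' : integral A' -> integral B ->
  cong D A B -> cong D A' B' -> cong D (A * A') (B * B').
Proof.
by move=> iA' iB /(congMr iA') h /(congMl iB); apply: cong_trans.
Qed.

Lemma cong_integral D A B : integral D -> cong D A B -> integral B -> integral A.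
Proof.
move=> iD [z iz e] iB; rewrite -(subrK B A) e; exact/integralD/iB/integralM.
Qed.

Lemma congV D A B : A != 0 -> B != 0 -> integral A^-1 -> integral B^-1 ->
  cong D A B -> cong D A^-1 B^-1.
Proof.
move=> A0 B0 iA iB [z iz e]; exists (- z * (A^-1 * B^-1)).
  by apply: integralM; [apply: integralN | apply: integralM].
by rewrite mulrA mulrN -e; field; rewrite A0 B0.
Qed.

Lemma cong_sum D (I : eqType) (s : seq I) (h h' : I -> F) :
  (forall i, i \in s -> cong D (h i) (h' i)) ->
  cong D (\sum_(i <- s) h i) (\sum_(i <- s) h' i).
Proof.
move=> ih; rewrite big_seq [X in cong _ _ X]big_seq.
elim/big_rec2: _ => [|i A B si IH]; first exact: congxx.
by apply: congD => //; apply: ih.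
Qed.

Lemma cong_prod D (I : eqType) (s : seq I) (h h' : I -> F) :
    integral D -> (forall i, i \in s -> integral (h' i)) ->
  (forall i, i \in s -> cong D (h i) (h' i)) ->
  cong D (\prod_(i <- s) h i) (\prod_(i <- s) h' i).
Proof.
move=> iD ih hh; rewrite big_seq [X in cong _ _ X]big_seq.
(* Integrality of the left product is carried along, as [congM] needs an integral cofactor. *)
suff: integral (\prod_(i <- s | i \in s) h i) /\
   cong D (\prod_(i <- s | i \in s) h i) (\prod_(i <- s | i \in s) h' i) by case.
elim/big_rec2: _ => [|i A B si [IA IH]].
  by split; [exact: integral1 | apply: congxx].
have ii := cong_integral iD (hh _ si) (ih _ si).
split; first exact: integralM.
by apply: congM => //; [apply: ih | apply: hh].
Qed.

Lemma congX D A B k : integral D -> integral B -> cong D A B ->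
  cong D (A ^+ k) (B ^+ k).
Proof.
move=> iD iB h; have iA := cong_integral iD h iB.
elim: k => [|k IHk]; first exact: congxx.
by rewrite !exprS; apply: congM => //; apply: integralX.
Qed.

Lemma cong_qpoch D a a' b k : integral D -> integral a' -> integral b ->
  cong D a a' -> cong D (qpoch a b k) (qpoch a' b k).
Proof.
move=> iD ia ib h; apply: cong_prod => // i _.
  by apply: integralB => //; apply/integralM/integralX.
apply: congD; first exact: congxx.
by apply: congN; apply: congMr => //; apply: integralX.
Qed.

(* [(1 - z y) (1 - z / y) - (1 - z)^2 = - (z / y) (1 - y)^2] *)
Lemma cong_qpoch_pair b p y k : y != 0 ->
    integral b -> integral p -> integral y -> integral y^-1 ->
  cong ((1 - y) ^+ 2) (qpoch (b / y) p k * qpoch (b * y) p k) (qpoch b p k ^+ 2).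
Proof.
move=> y0 ib ip iy iV; rewrite [qpoch b p k ^+ 2]expr2 /qpoch -!big_split /=.
have ibp i : integral (b * p ^+ i) by apply/integralM/integralX.
apply: cong_prod => [|i _|i _].
- by apply/integralX/integralB.
- by apply: integralM; apply: integralB.
exists (- (b * p ^+ i * y^-1)); first by apply/integralN/integralM.
by field.
Qed.

(** * The double sum over a subring where 1 - q^e is a unit unless n divides e *)

Section DoubleSum.
Variables (q : F) (n d m : nat).
Hypotheses (n_gt1 : (1 < n)%N) (n_odd : odd n) (d_gt0 : (0 < d)%N)
  (co_nd : coprime n d) (m_lt : (2 * m < n)%N).
Hypotheses (q_neq0 : q != 0) (q_free : forall e : int, e != 0 -> q ^ e != 1).
Hypotheses (integral_q : forall e : int, integral (q ^ e))
  (integral_qV : forall e : int, ~~ (n%:Z %| e)%Z -> integral (1 - q ^ e)^-1)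
  (integral_half : integral 2^-1) (two_neq0 : (2 : F) != 0).

Let r : int := n%:Z - (d * m)%:Z.
Let p := q ^+ (2 * d).
Let x := q ^ r.
Let y := q ^+ (2 * n).

(** * Nonvanishing and integrality of the elementary factors *)

Let pXE i : p ^+ i = q ^ (2 * d * i)%:Z.
Proof. by rewrite /p -exprM. Qed.

Let xpE i : x * p ^+ i = q ^ (n%:Z + (2 * d * i)%:Z - (d * m)%:Z).
Proof. by rewrite pXE /x -expfzDr //; congr (q ^ _); rewrite /r; ring. Qed.

Let x2E : x ^+ 2 = q ^ (2 * r).
Proof. by rewrite /x exprnP exprz_exp mulrC. Qed.

Let x2pE i : x ^+ 2 * p ^+ i = q ^ (2 * (n%:Z + d%:Z * i%:Z - (d * m)%:Z)).
Proof. by rewrite pXE x2E -expfzDr //; congr (q ^ _); rewrite /r; lia. Qed.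

Let yE : y = x ^+ 2 * p ^+ m.
Proof. by rewrite x2pE /y exprnP; congr (q ^ _); lia. Qed.

(** As [n] is odd and prime to [d], divisibility would force [n] to divide [e]. Modulo [n], the
    exponents of p^(i+1), y p^(i+1), p^(i+1) / y and x^2 p^i have this shape. *)
Lemma n_ndvd_shift (e : int) :
  e != 0 -> (`|e| < n)%N -> ~~ (n%:Z %| 2 * (n%:Z + d%:Z * e))%Z.
Proof.
move=> e0 lte; rewrite Gauss_dvdzr; last first.
  by rewrite coprimezE coprimen2.
rewrite rpredDl ?dvdzz //.
rewrite Gauss_dvdzr; last by rewrite coprimezE.
by rewrite dvdzE gtnNdvd // lt0n absz_eq0.
Qed.

(** Half the exponent of x^2 p^i. If it were zero, [d] would divide [n], hence d = 1 and n = m - i,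
    against 2m < n. *)
Lemma index_neq0 i : n%:Z + d%:Z * i%:Z - (d * m)%:Z != 0.
Proof.
apply/negP => /eqP e.
have : (d %| n)%N.
  have : (d%:Z %| n%:Z)%Z.
    apply/dvdzP; exists (m%:Z - i%:Z); move: e; lia.
  by [].
move=> dn; have d1 : d = 1%N.
  by move: co_nd; rewrite /coprime; move/gcdn_idPr: dn => -> /eqP.
by move: e; rewrite d1; lia.
Qed.

Let p0 : p != 0. Proof. by rewrite expf_neq0. Qed.
Let x0 : x != 0. Proof. exact: expfz_neq0. Qed.
Let y0 : y != 0. Proof. by rewrite expf_neq0. Qed.

Let p_free i : p ^+ i.+1 != 1.
Proof. by rewrite pXE q_free //; lia. Qed.

Let x2_free i : x ^+ 2 * p ^+ i != 1.
Proof. by rewrite x2pE q_free // mulf_neq0 // index_neq0. Qed.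

Let xp_free i : x * p ^+ i != 1.
Proof.
apply: contraNneq (x2_free (i + i)%N) => e.
by rewrite exprD expr2 mulrACA e mulr1.
Qed.

Let integral_p : integral p. Proof. by rewrite /p exprnP. Qed.
Let integral_x : integral x. Proof. exact: integral_q. Qed.
Let integral_xV : integral x^-1. Proof. by rewrite /x invr_expz. Qed.
Let integral_y : integral y. Proof. by rewrite /y exprnP. Qed.
Let integral_yV : integral y^-1. Proof. by rewrite /y exprnP invr_expz. Qed.

Let integral_pV i : (i.+1 < n)%N -> integral (1 - p ^+ i.+1)^-1.
Proof.
move=> lti; rewrite pXE; apply: integral_qV.
have -> : (2 * d * i.+1)%:Z = 2 * (n%:Z + d%:Z * i.+1%:Z) - n%:Z * 2 by ring.
by rewrite (rpredBr _ (dvdz_mulr _ (dvdzz _))) n_ndvd_shift.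
Qed.

Let integral_ypV i : (i.+1 < n)%N -> integral (1 - y * p ^+ i.+1)^-1.
Proof.
move=> lti; rewrite /y pXE exprnP -expfzDr //; apply: integral_qV.
have -> : (2 * n)%:Z + (2 * d * i.+1)%:Z = 2 * (n%:Z + d%:Z * i.+1%:Z) by lia.
by rewrite n_ndvd_shift.
Qed.

Let yVp i : y^-1 * p ^+ i = q ^ (2 * (n%:Z + d%:Z * i%:Z) - n%:Z * 4).
Proof. by rewrite /y pXE exprnP invr_expz -expfzDr //; congr (q ^ _); lia. Qed.

Let integral_yVpV i : (i.+1 < n)%N -> integral (1 - y^-1 * p ^+ i.+1)^-1.
Proof.
move=> lti; rewrite yVp; apply: integral_qV.
by rewrite (rpredBr _ (dvdz_mulr _ (dvdzz _))) n_ndvd_shift.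
Qed.

Let yVp_free i : (i < m)%N -> y^-1 * p ^+ i.+1 != 1.
Proof.
move=> lti; rewrite yVp q_free //; apply/negP => /eqP e.
have := @n_ndvd_shift i.+1 isT; rewrite (_ : 2 * _ = n%:Z * 4); last first.
  by apply/eqP; rewrite -subr_eq0 e.
by rewrite dvdz_mulr //; move/(_ _)/negP; apply => //; lia.
Qed.

Let integral_x2V i : (i < m)%N -> integral (1 - x ^+ 2 * p ^+ i)^-1.
Proof.
move=> lti; rewrite x2pE; apply: integral_qV.
have -> : n%:Z + d%:Z * i%:Z - (d * m)%:Z = n%:Z + d%:Z * (i%:Z - m%:Z) by lia.
by apply: n_ndvd_shift; lia.
Qed.

Let x1 : 1 - x != 0.
Proof. by rewrite subr_eq0 eq_sym -[x]mulr1 -(expr0 p). Qed.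

Let x1' : 1 + x != 0.
Proof.
apply: contraNneq (x2_free 0) => e.
by rewrite expr0 mulr1 -subr_eq0 -[1](expr1n _ 2) subr_sqr addrC [x + 1]addrC e mulr0.
Qed.

(** Here 1 / (1 + x) = (1 - x) / (1 - x^2), and 1 - x^2 is a unit once m > 0. For m = 0, x = q^n and
    1 + x divides 1 - y. *)
Let integral_x1V : (0 < m)%N -> integral (1 + x)^-1.
Proof.
move=> m0; have -> : (1 + x)^-1 = (1 - x) * (1 - x ^+ 2 * p ^+ 0)^-1.
  rewrite expr0 mulr1 (_ : 1 - x ^+ 2 = (1 - x) * (1 + x)); last by ring.
  by field; rewrite x1' x1.
by apply: integralM; [apply: integralB | apply: integral_x2V].
Qed.

(** The exponent of x p^k is n + d (2k - m), divisible by [n] only if 2k = m. Then x p^k = q^n, and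
    1 - q^n divides 1 - y. *)
Let integral_y_xpV k : (k <= m)%N -> integral ((1 - y) * (1 - x * p ^+ k)^-1).
Proof.
move=> lek; rewrite xpE; set e := (_ - _ : int).
have [ne|ne] := boolP (n%:Z %| e)%Z; last first.
  by apply: integralM; [apply: integralB | apply: integral_qV].
have -> : e = n%:Z.
  have [k2|k2] := eqVneq (2 * k)%N m; first by rewrite /e; lia.
  have := @n_ndvd_shift ((2 * k)%:Z - m%:Z); rewrite subr_eq0.
  have -> : n%:Z + d%:Z * ((2 * k)%:Z - m%:Z) = e by rewrite /e; lia.
  by rewrite dvdz_mull // => /(_ k2)/(_ _)/negP; case=> //; lia.
have xn : 1 - q ^ n%:Z != 0 by rewrite subr_eq0 eq_sym q_free //; lia.
have -> : (1 - y) / (1 - q ^ n%:Z) = 1 + q ^ n%:Z.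
  apply: (mulIf xn); rewrite divfK // /y mulnC exprM -exprnP; ring.
exact: integralD.
Qed.

Let qp_pV k : (k < n)%N -> integral (qpoch p p k)^-1.
Proof.
move=> ltk; apply: integral_qpochV => i lti; rewrite -exprS.
by apply: integral_pV; lia.
Qed.

Let qp_neq0 k : qpoch p p k != 0.
Proof. by apply: qpoch_neq0 => i _; rewrite -exprS. Qed.

(** * The truncated sum modulo (1 - y)^2 *)

Let D := (1 - y) ^+ 2.
Let integral_D : integral D. Proof. exact/integralX/integralB. Qed.

Let term k := (1 + x * p ^+ k) / (1 + x) * (qpoch (x ^+ 2) p k ^+ 2 / qpoch p p k ^+ 2)
  * ((-1) ^+ k * p ^+ 'C(k, 2) * (p / x) ^+ k).

(** The summand of the right-hand side, with (x; p)_k / (x p; p)_k collapsed to (1 - x) / (1 - x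
    p^k). *)
Let ratio k := qpoch (x ^+ 2) p k / qpoch p p k
  * ((1 - x) / (1 - x * p ^+ k)) * (p / x ^+ 2) ^+ k.

Let factor := qpoch (x ^+ 2 * p) p m / qpoch (p / y) p m.

Let integral_xpow k : integral ((-1) ^+ k * p ^+ 'C(k, 2) * (p / x) ^+ k).
Proof.
apply: integralM; last by apply/integralX/integralM.
by apply: integralM; apply: integralX => //; apply: integralN.
Qed.

Let integral_dV : integral (qpoch (p / y) p m)^-1.
Proof.
apply: integral_qpochV => i lti.
by rewrite mulrAC -exprS mulrC; apply: integral_yVpV; lia.
Qed.

Let sum_term_cong :
  cong D (\sum_(k < m.+1) term k)
    (factor * \sum_(k < m.+1) qpoch (x ^+ 2 / y) p k * qpoch (x ^+ 2 * y) p k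
        / (qpoch p p k * qpoch (x ^+ 2) p k)
        * ((1 - x) / (1 - x * p ^+ k)) * (p / x ^+ 2) ^+ k).
Proof.
rewrite -(deformed_sum p0 x0 yE p_free x2_free yVp_free).
apply: cong_sum => k _; move: {k}(k : nat) (leq_ord k) => k lek.
have i2 : integral (x ^+ 2) by apply: integralX.
have ipy : integral (qpoch (p * y) p k)^-1.
  apply: integral_qpochV => i lti.
  by rewrite mulrAC -exprS mulrC; apply: integral_ypV; lia.
have ipyV : integral (qpoch (p / y) p k)^-1.
  apply: integral_qpochV => i lti.
  by rewrite mulrAC -exprS mulrC; apply: integral_yVpV; lia.
have ipp : integral (qpoch p p k)^-1 by apply: qp_pV; lia.
apply: congMr => //; apply: congMl.
  (* For k = 0 the quotient is 1 even if 1 + x is not a unit; k > 0 forces m > 0, where it is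
     one. *)
  case: k lek {ipy ipyV ipp} => [|k] lek; first by rewrite expr0 mulr1 divff.
  apply: integralM; first by apply: integralD => //; apply/integralM/integralX.
  by apply: integral_x1V; lia.
apply: congM.
- by rewrite -exprVn; apply: integralX.
- by apply: integralM; apply: integral_qpoch => //; apply: integralM.
- by apply: cong_sym; apply: cong_qpoch_pair.
- apply: congV.
  + by rewrite expf_neq0.
  + rewrite mulf_neq0 //; apply: qpoch_neq0 => i lti.
      rewrite mulrAC -exprS /y pXE exprnP -expfzDr // q_free //; lia.
    by rewrite mulrAC -exprS mulrC yVp_free //; lia.
  + by rewrite -exprVn; apply: integralX.
  + by rewrite invfM; apply: integralM.
  by apply: cong_sym; rewrite mulrC; apply: cong_qpoch_pair.
Qed.

Let integral_factor k : (k <= m)%N ->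
  integral (factor * ((1 - x) / (1 - x * p ^+ k))).
Proof.
case: (posnP m) => [m0|m0] lek.
  have -> : k = 0%N by lia.
  by rewrite /factor m0 !qpoch0 expr0 mulr1 !divff ?oner_neq0 // mulr1.
(* The last factor of (x^2 p; p)_m is 1 - x^2 p^m = 1 - y; it compensates the denominator 1 - x
   p^k. *)
have -> : factor = (1 - y) * (qpoch (x ^+ 2 * p) p m.-1 / qpoch (p / y) p m).
  rewrite /factor -{1}(prednK m0) qpochS -[x ^+ 2 * p * _]mulrA -exprS (prednK m0) -yE; ring.
rewrite [(1 - x) / _]mulrC mulrACA; apply: integralM; first exact: integral_y_xpV.
apply: integralM; last exact: integralB.
by apply: integralM => //; apply: integral_qpoch => //; apply/integralM/integral_p/integralX.
Qed.

Let integral_x2p k : integral ((p / x ^+ 2) ^+ k).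
Proof. by apply/integralX/integralM => //; rewrite -exprVn; apply: integralX. Qed.

(** [factor] stays attached to each summand, because 1 / (1 - x p^k) alone may fail to be
    integral. *)
Let sum_ratio_cong :
  cong D (factor * \sum_(k < m.+1) qpoch (x ^+ 2 / y) p k * qpoch (x ^+ 2 * y) p k
        / (qpoch p p k * qpoch (x ^+ 2) p k)
        * ((1 - x) / (1 - x * p ^+ k)) * (p / x ^+ 2) ^+ k)
   (factor * \sum_(k < m.+1) ratio k).
Proof.
rewrite !mulr_sumr; apply: cong_sum => k _.
move: {k}(k : nat) (leq_ord k) => k lek.
have ix : integral (qpoch (x ^+ 2) p k)^-1.
  by apply: integral_qpochV => i lti; apply: integral_x2V; lia.
have nx : qpoch (x ^+ 2) p k != 0 by apply: qpoch_neq0 => i _.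
rewrite /ratio !mulrA; apply: congMr => //.
have E (A B : F) : factor * A / B * (1 - x) / (1 - x * p ^+ k)
    = factor * ((1 - x) / (1 - x * p ^+ k)) * (A / B) by ring.
rewrite -[factor * _ * qpoch _ _ _]mulrA.
rewrite !E; apply: congMl; first exact: integral_factor.
have -> : qpoch (x ^+ 2) p k / qpoch p p k
   = qpoch (x ^+ 2) p k ^+ 2 / (qpoch p p k * qpoch (x ^+ 2) p k).
  by field; rewrite qp_neq0 nx.
apply: congMr.
  by rewrite invfM; apply: integralM => //; apply: qp_pV; lia.
by apply: cong_qpoch_pair => //; apply: integralX.
Qed.

Let integral_factor_ratio : integral (factor * \sum_(k < m.+1) ratio k).
Proof.
rewrite mulr_sumr; apply: integral_sum => k _.
move: {k}(k : nat) (leq_ord k) => k lek.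
rewrite /ratio [qpoch _ _ _ / _ * _]mulrC mulrA mulrA; apply: integralM => //.
apply: integralM; first exact: integral_factor.
by apply: integralM; [apply: integral_qpoch => //; apply: integralX | apply: qp_pV; lia].
Qed.

Let sum_cong :
  cong D ((\sum_(k < m.+1) term k) ^+ 2) ((factor * \sum_(k < m.+1) ratio k) ^+ 2).
Proof. by apply: congX => //; apply: cong_trans sum_ratio_cong. Qed.

(** * Truncation of the double sum for m > 0 *)

Let integral_term k : (0 < m)%N -> (k < n)%N -> integral (term k).
Proof.
move=> m0 ltk; apply: integralM => //; apply: integralM.
  apply: integralM; last exact: integral_x1V.
  by apply: integralD => //; apply/integralM/integralX.
apply: integralM; first by apply/integralX/integral_qpoch => //; apply: integralX.
by rewrite -exprVn; apply/integralX/qp_pV.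
Qed.

(** For k > m the product (x^2; p)_k contains 1 - x^2 p^m = 1 - y, and it enters the term
    squared. *)
Let term_vanish k : (0 < m)%N -> (m < k < n)%N -> cong D (term k) 0.
Proof.
move=> m0 /andP[ltmk ltkn].
have i2 : integral (x ^+ 2) by apply: integralX.
have kE : k = (m.+1 + (k - m.+1))%N by lia.
pose z := qpoch (x ^+ 2) p m * qpoch (x ^+ 2 * p ^+ m.+1) p (k - m.+1).
exists ((1 + x * p ^+ k) / (1 + x) * (z ^+ 2 / qpoch p p k ^+ 2)
  * ((-1) ^+ k * p ^+ 'C(k, 2) * (p / x) ^+ k)).
  apply: integralM => //; apply: integralM.
    apply: integralM; last exact: integral_x1V.
    by apply: integralD => //; apply/integralM/integralX.
  apply: integralM; last by rewrite -exprVn; apply/integralX/qp_pV.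
  apply: integralX; apply: integralM; apply: integral_qpoch => //.
  by apply/integralM/integralX.
rewrite subr0 /term {2}kE qpochD qpochS -yE /D /z; ring.
Qed.

Let double_sum_cong_gt0 : (0 < m)%N ->
  cong D (\sum_(k < n) \sum_(j < k.+1) term j * term (k - j)%N)
         ((\sum_(k < m.+1) term k) ^+ 2).
Proof.
move=> m0; rewrite -(double_sum_square _ m_lt).
have trunc k : (k < n)%N -> cong D (term k) (if (k < m.+1)%N then term k else 0).
  move=> ltk; case: ifP => [_|/negbT]; first exact: congxx.
  by rewrite -leqNgt => ltm; apply: term_vanish => //; rewrite ltm.
apply: cong_sum => k _; apply: cong_sum => j _.
have ltkj : (k - j < n)%N by apply: leq_ltn_trans (leq_subr _ _) (ltn_ord k).
have ltj : (j < n)%N by apply: leq_ltn_trans (leq_ord j) (ltn_ord k).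
apply: congM; [exact: integral_term | | exact: trunc | exact: trunc].
case: ifP => _; [exact: integral_term | exact: integral0].
Qed.

(** * The case m = 0, where x = q^n and 1 - y = (1 - x) (1 + x) *)

Section Zero.
Hypothesis m_eq0 : m = 0%N.

Let yE0 : y = x ^+ 2. Proof. by rewrite yE m_eq0 expr0 mulr1. Qed.
Let I := 1 + x.
Let integral_I : integral I. Proof. exact: integralD. Qed.

Let x_cong : cong I x (-1).
Proof. by exists 1 => //; rewrite opprK mulr1 addrC. Qed.

Let x2_cong : cong I (x ^+ 2) 1.
Proof. by exists (x - 1); [apply: integralB | rewrite /I; ring]. Qed.

Let pn_cong j : cong I ((p ^+ n) ^+ j) 1.
Proof.
rewrite -[X in cong _ _ X](expr1n _ j); apply: congX => //.
have -> : p ^+ n = (x ^+ 2) ^+ d.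
  by rewrite -yE0 /y /p -!exprM; congr (_ ^+ _); lia.
by rewrite -[X in cong _ _ X](expr1n _ d); apply: congX.
Qed.

(** [term k.+1] divided by (1 + x) (1 - x)^2; this quotient is integral for k + 1 < n. *)
Let v k := (1 + x * p ^+ k.+1) * (qpoch (x ^+ 2 * p) p k ^+ 2 / qpoch p p k.+1 ^+ 2)
  * ((-1) ^+ k.+1 * p ^+ 'C(k.+1, 2) * (p / x) ^+ k.+1).

Let integral_v k : (k.+1 < n)%N -> integral (v k).
Proof.
move=> ltk; apply: integralM => //; apply: integralM.
  by apply: integralD => //; apply/integralM/integralX.
apply: integralM; last by rewrite -exprVn; apply/integralX/qp_pV.
by apply/integralX/integral_qpoch => //; apply: integralM => //; apply: integralX.
Qed.

Let term0 : term 0 = 1.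
Proof.
by rewrite /term !qpoch0 bin_small // !expr0 !expr1n !mulr1 !divff ?oner_neq0 // mulr1.
Qed.

Let termS k : term k.+1 = I * (1 - x) ^+ 2 * v k.
Proof.
rewrite /term qpochSl /v /I.
by field; rewrite ?x1' ?x0 ?qp_neq0.
Qed.

(** The value of [v k] at x = -1: the shifted factorials leave 1 / (1 - p^(k+1))^2, and the two
    signs cancel. *)
Let h k := p ^+ 'C(k.+1, 2) * p ^+ k.+1 / (1 - p ^+ k.+1).

Let v_cong k : (k.+1 < n)%N -> cong I (v k) (h k).
Proof.
move=> ltk.
have ipp : integral (qpoch p p k)^-1 by apply: qp_pV; lia.
have ippS : integral (qpoch p p k.+1)^-1 by apply: qp_pV; lia.
have hE : h k = (1 + -1 * p ^+ k.+1) * (qpoch p p k ^+ 2 / qpoch p p k.+1 ^+ 2)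
    * (p ^+ 'C(k.+1, 2) * (1 * p) ^+ k.+1).
  have := qp_neq0 k.+1; rewrite qpochS -exprS mulf_eq0 negb_or mul1r => /andP[h1 h2].
  move: (qpoch p p k) h1 h2 => A h1 h2; rewrite /h.
  move: (p ^+ k.+1) h2 => X h2.
  by field; rewrite h1 h2.
have vE : v k = (1 + x * p ^+ k.+1) * (qpoch (x ^+ 2 * p) p k ^+ 2 / qpoch p p k.+1 ^+ 2)
    * (p ^+ 'C(k.+1, 2) * (- x^-1 * p) ^+ k.+1).
  have e : - x^-1 * p = -1 * (p / x) by ring.
    by rewrite e exprMn /v; ring.
have iXp (z : F) : integral z -> integral (z * p ^+ k.+1).
  by move=> iz; apply/integralM/integralX.
have iV2 : integral (qpoch p p k.+1 ^+ 2)^-1 by rewrite -exprVn; apply: integralX.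
have iq2 : integral (qpoch p p k ^+ 2) by apply/integralX/integral_qpoch.
have iN1 : integral (-1) by apply: integralN.
have iNx : integral (- x^-1 * p) by apply: integralM => //; apply: integralN.
rewrite hE vE; apply: congM.
- by apply: integralM; apply: integralX.
- by apply: integralM; [apply: integralD => //; apply: iXp | apply: integralM].
- apply: congM.
  + apply: integralM => //; apply/integralX/integral_qpoch => //.
    by apply: integralM => //; apply: integralX.
  + by apply: integralD => //; apply: iXp.
  + apply: congD; first exact: congxx.
    by apply: congMr => //; apply: integralX.
  apply: congMr => //; apply: congX => //; first exact: integral_qpoch.
  by apply: cong_qpoch => //; rewrite -[X in cong _ _ X]mul1r; apply: congMr.
apply: congMl; first exact: integralX.
apply: congX => //; first exact: integralM.
apply: congMr => //; exists (- x^-1); first exact: integralN.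
by rewrite /I; field.
Qed.

Let h_antisym k l : (k + l).+2 = n -> cong I (h l) (- h k).
Proof.
move=> nE.
(* Modulo [I] one has p^n = 1, so exponents of [p] matter only modulo [n]; (n + 1) / 2 is an integer
   as [n] is odd. *)
have e : ('C(l.+1, 2) + l.+1 + n * k.+1 = 'C(k.+1, 2) + n * (n.+1)./2)%N.
  have := odd_double_half n.+1; have := double_bin2 l; have := double_bin2 k.
  rewrite /= n_odd /= add0n -nE; nia.
have pnE : p ^+ n = p ^+ k.+1 * p ^+ l.+1 by rewrite -exprD -nE; congr (_ ^+ _); lia.
have ik : integral (1 - p ^+ k.+1)^-1 by apply: integral_pV; lia.
have il : integral (1 - p ^+ l.+1)^-1 by apply: integral_pV; lia.
have nk : 1 - p ^+ k.+1 != 0 by rewrite subr_eq0 eq_sym.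
have nl : 1 - p ^+ l.+1 != 0 by rewrite subr_eq0 eq_sym.
have ipV : integral (p ^+ k.+1)^-1 by rewrite pXE invr_expz.
have pk : p ^+ k.+1 != 0 by rewrite expf_neq0.
have iXk : integral (p ^+ k.+1) by apply: integralX.
have iXl : integral (p ^+ l.+1) by apply: integralX.
have -> : - h k = p ^+ 'C(k.+1, 2) * (p ^+ k.+1 / (p ^+ k.+1 - 1)).
  by rewrite /h; field; rewrite nk -opprB oppr_eq0 nk.
(* Expanding the fraction by p^(k+1) brings p^n into the denominator, where it may be replaced by
   1. *)
have -> : h l = p ^+ ('C(l.+1, 2) + l.+1) * (p ^+ k.+1 / (p ^+ k.+1 - p ^+ n)).
  rewrite pnE exprD /h.
  have E : p ^+ k.+1 - p ^+ k.+1 * p ^+ l.+1 = p ^+ k.+1 * (1 - p ^+ l.+1) by ring.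
  by rewrite E; field; rewrite nl pk.
have EV : p ^+ k.+1 - p ^+ n = p ^+ k.+1 * (1 - p ^+ l.+1) by rewrite pnE; ring.
have EV1 : p ^+ k.+1 - 1 = - (1 - p ^+ k.+1) by rewrite opprB.
apply: congM.
- apply: integralM => //; rewrite EV invfM; exact: integralM.
- exact: integralX.
- apply: (@cong_trans _ (p ^+ ('C(l.+1, 2) + l.+1 + n * k.+1))).
    rewrite [X in cong _ _ X]exprD exprM -[X in cong _ X _]mulr1.
    by apply: congMl; [apply: integralX | apply: cong_sym].
  rewrite e exprD exprM -[X in cong _ _ X]mulr1.
  by apply: congMl; [apply: integralX | ].
apply: congMl => //; apply: congV.
- by rewrite EV mulf_neq0.
- by rewrite EV1 oppr_eq0.
- by rewrite EV invfM; apply: integralM.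
- by rewrite EV1 invrN; apply: integralN.
apply: congD; first exact: congxx.
by apply: congN; rewrite -[p ^+ n]expr1.
Qed.

(** Reversing the summation shows that the sum is congruent to its negative, and 2 is a unit. *)
Let sum_h_cong : cong I (\sum_(k < n.-1) h k) 0.
Proof.
set s := \sum_(k < _) _.
have [z iz e] : cong I s (- s).
  rewrite {1}/s (reindex_inj rev_ord_inj) /= -sumrN.
  by apply: cong_sum => k _; apply: h_antisym; have := ltn_ord k; lia.
exists (2^-1 * z); first exact: integralM.
apply: (mulfI two_neq0); rewrite mulrCA [2 * (2^-1 * _)]mulrA divff // mul1r -e; ring.
Qed.

(** Since [term 0] is 1, the two end terms of an inner sum contribute 2 [term k.+1], and all other
    products are divisible by [D]. What remains is 2 (1 + x) (1 - x)^2 times the sum of [v k], which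
    supplies the second factor 1 + x. *)
Lemma double_sum_cong_0 :
  cong D (\sum_(k < n) \sum_(j < k.+1) term j * term (k - j)%N)
         ((\sum_(k < m.+1) term k) ^+ 2).
Proof.
rewrite m_eq0 big_ord_recl big_ord0 addr0 term0 expr1n.
have DE : D = I ^+ 2 * (1 - x) ^+ 2 by rewrite /D yE0 /I; ring.
have ix : integral ((1 - x) ^+ 2) by apply/integralX/integralB.
rewrite -[in X in cong _ X _](prednK (ltnW n_gt1)) big_ord_recl big_ord_recl big_ord0.
rewrite addr0 !term0 mulr1 -[X in cong _ _ X]addr0; apply: congD; first exact: congxx.
apply: (@cong_trans _ (\sum_(k < n.-1) (2 * (I * (1 - x) ^+ 2)) * v k)).
  apply: cong_sum => k _; rewrite lift0.
  have mid : cong D (\sum_(i < k) term i.+1 * term (k - i)%N) 0.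
    have E0 : 0 = \sum_(i < k) (0 : F) by rewrite big1.
    rewrite [X in cong _ _ X]E0.
    apply: cong_sum => i _; exists ((1 - x) ^+ 2 * (v i * v (k - i).-1)).
      have := ltn_ord i; have := ltn_ord k => ? ?.
      by apply: integralM => //; apply: integralM; apply: integral_v; lia.
    by rewrite -{1}(prednK (_ : 0 < k - i)%N) ?subn_gt0 // !termS DE; ring.
  rewrite big_ord_recl big_ord_recr /= /bump /= subn0 term0 mul1r add1n subnn term0 mulr1.
  rewrite (_ : 2 * _ * v k = term k.+1 + (0 + term k.+1)); last by rewrite termS; ring.
  apply: congD; first exact: congxx.
  apply: congD; last exact: congxx.
  by under eq_bigr => i _ do rewrite add1n subSS.
rewrite -mulr_sumr.
have [z iz e] : cong I (\sum_(k < n.-1) v k) 0.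
  apply: cong_trans sum_h_cong; apply: cong_sum => k _; apply: v_cong.
  by have := ltn_ord k; lia.
exists (2 * z); first by apply: integralM => //; apply: integralD.
by rewrite subr0 -[\sum_(_ < _) _]subr0 e DE; ring.
Qed.
End Zero.

Let term_sum_cong :
  cong D (\sum_(k < n) \sum_(j < k.+1) term j * term (k - j)%N)
         ((factor * \sum_(k < m.+1) ratio k) ^+ 2).
Proof.
apply: cong_trans sum_cong.
by case: (posnP m) => m0; [exact: double_sum_cong_0 | exact: double_sum_cong_gt0].
Qed.

(** * Translation from the notation of the statement *)

Let termE k :
  (-1) ^+ k
  * ((1 + q ^ ((2 * d * k)%:Z + r)) * qpoch (q ^ (2 * r)) (q ^+ (2 * d)) k ^+ 2)
  / ((1 + q ^ r) * qpoch (q ^+ (2 * d)) (q ^+ (2 * d)) k ^+ 2)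
  * q ^ ((d * k ^ 2)%:Z + k%:Z * (d%:Z - r)) = term k.
Proof.
rewrite -/p -/x -x2E /term.
have -> : q ^ ((2 * d * k)%:Z + r) = x * p ^+ k by rewrite pXE expfzDr // mulrC.
(* On exponents: d k^2 + k (d - r) = d k (k - 1) + k (2d - r). *)
have -> : q ^ ((d * k ^ 2)%:Z + k%:Z * (d%:Z - r)) = p ^+ 'C(k, 2) * (p / x) ^+ k.
  have -> : p / x = q ^ ((2 * d)%:Z - r) by rewrite /x invr_expz /p exprnP -expfzDr.
  rewrite pXE exprnP exprz_exp -expfzDr //.
  congr (q ^ _); case: k => [|k]; first by rewrite bin_small //; lia.
  by have := double_bin2 k; nia.
by rewrite invfM; ring.
Qed.

Let ratioE k :
  (qpoch (q ^ (2 * r)) (q ^+ (2 * d)) k * qpoch (q ^ r) (q ^+ (2 * d)) k)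
          / (qpoch (q ^+ (2 * d)) (q ^+ (2 * d)) k
             * qpoch (q ^ ((2 * d)%:Z + r)) (q ^+ (2 * d)) k)
          * q ^ (2 * k%:Z * (d%:Z - r)) = ratio k.
Proof.
rewrite -/p -/x -x2E /ratio.
have -> : q ^ ((2 * d)%:Z + r) = x * p by rewrite expfzDr // mulrC.
have -> : q ^ (2 * k%:Z * (d%:Z - r)) = (p / x ^+ 2) ^+ k.
  have -> : p / x ^+ 2 = q ^ ((2 * d)%:Z - 2 * r).
    by rewrite x2E invr_expz /p exprnP -expfzDr.
  rewrite exprnP exprz_exp.
  by congr (q ^ _); lia.
have xpk : 1 - x * p ^+ k != 0 by rewrite subr_eq0 eq_sym.
have H : qpoch x p k * (1 - x * p ^+ k) = (1 - x) * qpoch (x * p) p k.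
  by rewrite -qpochS qpochSl.
have -> : qpoch x p k = (1 - x) * qpoch (x * p) p k / (1 - x * p ^+ k).
  by rewrite -H mulfK.
have nxp : qpoch (x * p) p k != 0.
  by apply: qpoch_neq0 => i _; rewrite -mulrA -exprS.
congr (_ * _); move: (qpoch (x * p) p k) nxp => A A0.
by field; rewrite A0 qp_neq0 xpk.
Qed.

(** One has (x^2 p; p)_m = (x^2; p)_m (1 - y) / (1 - x^2), and flipping (x^2; p)_m cancels (p / y;
    p)_m, leaving (1 - y) / (1 - x^2) times a signed power of [q]. *)
Let factorE : factor ^+ 2 =
  qint (q ^+ 2) n%:Z ^+ 2 / qint (q ^+ 2) r ^+ 2
  * q ^ (2 * m%:Z * (2 * n%:Z - (d * m)%:Z - d%:Z)).
Proof.
have -> : q ^ (2 * m%:Z * (2 * n%:Z - (d * m)%:Z - d%:Z))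
   = ((- x ^+ 2) ^+ m * p ^+ 'C(m, 2)) ^+ 2.
  rewrite exprMn exprAC sqrrN -[(_ ^+ 2) ^+ m]exprM -[(p ^+ _) ^+ 2]exprM.
  rewrite x2E pXE exprnP exprz_exp -expfzDr //.
  congr (q ^ _); rewrite /r; case: (m) => [|k]; first by rewrite bin_small //; lia.
  by have := double_bin2 k; nia.
have xx : x ^+ 2 != 0 by rewrite expf_neq0.
have a1 : 1 - x ^+ 2 != 0 by have := x2_free 0; rewrite expr0 mulr1 subr_eq0 eq_sym.
have H : qpoch (x ^+ 2) p m * (1 - y) = (1 - x ^+ 2) * qpoch (x ^+ 2 * p) p m.
  by rewrite yE -qpochS qpochSl.
have q21 : 1 - q ^+ 2 != 0 by rewrite subr_eq0 eq_sym exprnP q_free.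
have -> : qint (q ^+ 2) n%:Z = (1 - y) / (1 - q ^+ 2).
  by rewrite /qint -exprnP -exprM.
have -> : qint (q ^+ 2) r = (1 - x ^+ 2) / (1 - q ^+ 2).
  by rewrite /qint x2E exprnP exprz_exp.
rewrite /factor; have -> : qpoch (x ^+ 2 * p) p m
    = qpoch (x ^+ 2) p m * (1 - y) / (1 - x ^+ 2) by rewrite H; field.
have nz : qpoch (p / y) p m != 0.
  apply: qpoch_neq0 => i lti.
  by rewrite mulrAC -exprS mulrC yVp_free.
rewrite (qpoch_flip m p0 xx) -yE.
move: (qpoch (p / y) p m) nz => A A0.
move: (_ * p ^+ 'C(m, 2)) => B.
by field; rewrite A0 a1 q21.
Qed.

Lemma double_sum_cong (c : nat -> F) :
    (forall k, c k = (-1) ^+ k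
        * ((1 + q ^ ((2 * d * k)%:Z + r)) * qpoch (q ^ (2 * r)) (q ^+ (2 * d)) k ^+ 2)
        / ((1 + q ^ r) * qpoch (q ^+ (2 * d)) (q ^+ (2 * d)) k ^+ 2)
        * q ^ ((d * k ^ 2)%:Z + k%:Z * (d%:Z - r))) ->
  cong ((1 - q ^+ (2 * n)) ^+ 2)
    (\sum_(0 <= k < n) \sum_(0 <= j < k.+1) c j * c (k - j)%N)
    (qint (q ^+ 2) n%:Z ^+ 2 / qint (q ^+ 2) r ^+ 2
     * q ^ (2 * m%:Z * (2 * n%:Z - (d * m)%:Z - d%:Z))
     * (\sum_(0 <= k < m.+1)
          (qpoch (q ^ (2 * r)) (q ^+ (2 * d)) k * qpoch (q ^ r) (q ^+ (2 * d)) k)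
          / (qpoch (q ^+ (2 * d)) (q ^+ (2 * d)) k
             * qpoch (q ^ ((2 * d)%:Z + r)) (q ^+ (2 * d)) k)
          * q ^ (2 * k%:Z * (d%:Z - r))) ^+ 2).
Proof.
move=> cE; rewrite -factorE -exprMn !big_mkord.
under eq_bigr => k _ do rewrite big_mkord.
under eq_bigr => k _ do under eq_bigr => j _ do rewrite !cE !termE.
under [X in cong _ _ ((_ * X) ^+ 2)]eq_bigr => k _ do rewrite ratioE.
exact: term_sum_cong.
Qed.
End DoubleSum.
End Congruence.

(** * Rational functions regular at the roots of a polynomial *)

Section Localization.
Variable P : {poly rat}.
Implicit Types (A B C D : ratfun).

Definition regular A :=
  exists s t : {poly rat}, [/\ t != 0, coprimep t P & A = s%:F / t%:F].

Lemma regular_poly s : regular s%:F.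
Proof. by exists s, 1; rewrite oner_neq0 coprime1p tofrac1 divr1. Qed.

Lemma regularD A B : regular A -> regular B -> regular (A + B).
Proof.
move=> [s [t [t0 tP ->]]] [s' [t' [t0' tP' ->]]].
exists (s * t' + s' * t), (t * t'); rewrite mulf_neq0 // coprimepMl tP tP'.
by split=> //; rewrite tofracD !tofracM addf_div ?tofrac_eq0.
Qed.

Lemma regularM A B : regular A -> regular B -> regular (A * B).
Proof.
move=> [s [t [t0 tP ->]]] [s' [t' [t0' tP' ->]]].
exists (s * s'), (t * t'); rewrite mulf_neq0 // coprimepMl tP tP'.
by split=> //; rewrite !tofracM invfM mulrACA.
Qed.

Lemma regular1 : regular 1.
Proof. by have := regular_poly 1; rewrite tofrac1. Qed.

Lemma regularB A B : regular A -> regular B -> regular (A - B).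
Proof.
move=> iA iB; apply: regularD => //.
by rewrite -mulN1r -tofrac1 -tofracN; apply/regularM/iB/regular_poly.
Qed.

(** The difference is P^2 w^2 s / t; dividing both parts by their gcd reduces it. The gcd divides
    [t], hence is coprime to P^2, so P^2 still divides the reduced numerator. *)
Lemma cong_eqmod E A B : (exists w, E = P * w) ->
  cong regular (E%:F ^+ 2) A B -> eqmod_ratfun (P ^+ 2) A B.
Proof.
move=> [w ->] [_ [s [t [t0 tP ->]]] e].
have cP : coprimep t (P ^+ 2) by rewrite coprimep_expr.
pose U := P ^+ 2 * (w ^+ 2 * s); pose g := gcdp U t.
have gU : g %| U := dvdp_gcdl _ _; have gt : g %| t := dvdp_gcdr _ _.
have g0 : g != 0 by rewrite gcdp_eq0 (negPf t0) andbF.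
have tE : t = t %/ g * g by rewrite divpK.
have UE : U = U %/ g * g by rewrite divpK.
have v0 : t %/ g != 0 by apply: contraNneq t0 => h; rewrite tE h mul0r.
exists (U %/ g), (t %/ g); split => //.
- by apply: coprimep_div_gcd; rewrite t0 orbT.
- rewrite e tofracM exprMn mulrA -tofracXn -tofracXn -!tofracM.
  rewrite -mulrA -/U {1}UE {1}tE !tofracM -mulf_div divff ?mulr1 //.
  by rewrite tofrac_eq0.
- have : P ^+ 2 %| U by apply: dvdp_mulIl.
  by rewrite {1}UE Gauss_dvdpl // (coprimep_dvdl gt) // coprimep_sym.
- apply: coprimep_dvdr cP; by apply/dvdpP; exists g; rewrite {1}tE mulrC.
Qed.
End Localization.

(** * Cyclotomic divisibility and coprimality, tested on complex roots *)

Lemma root_Phi (n : nat) (z : algC) : (0 < n)%N ->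
  root (map_poly ratr (Phi n)) z = n.-primitive_root z.
Proof.
move=> n_gt0; have [w prim_w] := C_prim_root_exists n_gt0.
rewrite -(root_cyclotomic prim_w) -(Cintr_Cyclotomic prim_w) /Phi -map_poly_comp.
by congr (root _ z); apply: eq_map_poly => k /=; rewrite ratr_int.
Qed.

Lemma map_Phi_opp_horner (n : nat) (z : algC) :
  (map_poly ratr (Phi_opp n)).[z] = (map_poly ratr (Phi n)).[- z].
Proof.
by rewrite /Phi_opp map_comp_poly rmorphN /= map_polyX horner_comp hornerN hornerX.
Qed.

Lemma coprime_Phi_mul (t : {poly rat}) (n : nat) : (0 < n)%N ->
  (forall z : algC, root (map_poly ratr t) z ->
     ~~ n.-primitive_root z /\ ~~ n.-primitive_root (- z)) ->
  coprimep t (Phi_opp n * Phi n).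
Proof.
move=> n_gt0 h; rewrite -(coprimep_map (ratr : {rmorphism rat -> algC})).
apply/Pdiv.ClosedField.coprimepP => z /h[h1 h2].
rewrite rmorphM hornerM /= mulf_neq0 // ?map_Phi_opp_horner.
  by move: h2; rewrite -root_Phi // rootE.
by move: h1; rewrite -root_Phi // rootE.
Qed.

(** Let z^e = 1. If z is a primitive n-th root of unity, n divides e; if -z is one, (-z)^(2e) = 1
    gives n | 2e, and [n] is odd. *)
Lemma coprime_1subXn (n e : nat) : odd n -> (0 < n)%N -> ~~ (n %| e)%N ->
  coprimep (1 - 'X^e) (Phi_opp n * Phi n).
Proof.
move=> n_odd n_gt0 ne; apply: coprime_Phi_mul => // z.
rewrite rmorphB /= rmorph1 map_polyXn rootE !hornerE subr_eq0 => /eqP ze.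
split; apply: contra ne => /prim_order_dvd nE; first by rewrite nE -ze.
by rewrite -(@Gauss_dvdr n 2) ?coprimen2 // nE exprM sqrrN exprAC -ze expr1n.
Qed.

Lemma coprime_X (n : nat) : (0 < n)%N -> coprimep 'X (Phi_opp n * Phi n).
Proof.
move=> n_gt0; apply: coprime_Phi_mul => // z.
rewrite map_polyX rootE hornerX => /eqP ->; rewrite oppr0.
suff: ~~ n.-primitive_root (0 : algC) by [].
apply/negP => /prim_expr_order/eqP.
by rewrite expr0n gtn_eqF // eq_sym oner_eq0.
Qed.

(** [Phi n] divides X^n - 1; substituting -X, with [n] odd, shows that [Phi_opp n] divides X^n +
    1. *)
Lemma Phi_mul_dvd (n : nat) : odd n -> (0 < n)%N ->
  exists w, 1 - 'X^(2 * n) = (Phi_opp n * Phi n) * w :> {poly rat}.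
Proof.
move=> n_odd n_gt0.
have /dvdpP[w wE] : Phi n %| 'X^n - 1.
  have := prod_Cyclotomic n_gt0; rewrite (big_rem n) ?divisors_id //=.
  move/(congr1 (map_poly (intr : int -> rat))).
  rewrite rmorphM rmorphB /= rmorph1 map_polyXn => <-; exact: dvdp_mulr.
exists ((w \Po - 'X) * w).
have -> : 1 - 'X^(2 * n) = ('X^n - 1) * - (1 + 'X^n) :> {poly rat}.
  by rewrite mulnC exprM; ring.
have wE' : - (1 + 'X^n) = (w \Po - 'X) * Phi_opp n.
  rewrite /Phi_opp -comp_polyM -wE comp_polyB comp_Xn_poly comp_polyC exprNn.
  by rewrite -signr_odd n_odd expr1; ring.
by rewrite wE wE'; ring.
Qed.

Lemma inv_1subV (F : fieldType) (z : F) : z != 0 -> 1 - z != 0 ->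
  (1 - z^-1)^-1 = 1 - (1 - z)^-1.
Proof. by move=> z0 z1; field; rewrite z0 -[z - 1]opprB oppr_eq0 z1. Qed.

(** * Powers of [q] and units 1 - q^e in the localisation *)

Section Units.
Variable n : nat.
Hypotheses (n_gt1 : (1 < n)%N) (n_odd : odd n).
Let n_gt0 := ltnW n_gt1.
Let P := Phi_opp n * Phi n.

Lemma q_neq0 : q != 0.
Proof. by rewrite tofrac_eq0 polyX_eq0. Qed.

Lemma q_free (e : int) : e != 0 -> q ^ e != 1.
Proof.
have nat_case k : (0 < k)%N -> q ^+ k != 1.
  move=> k0; rewrite -tofracXn -tofrac1 tofrac_eq.
  apply/eqP => /(congr1 (fun p : {poly rat} => size p)).
  by rewrite size_polyXn size_poly1; case: k k0.
case: e => [[//|k]|k] _; first by rewrite -exprnP nat_case.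
by rewrite NegzE -invr_expz invr_eq1 nat_case.
Qed.

Lemma regular_qexp (e : int) : regular P (q ^ e).
Proof.
have iq : regular P q by apply: regular_poly.
have iqV : regular P q^-1.
  exists 1, 'X; rewrite polyX_eq0 coprime_X // tofrac1 mul1r.
  by split.
have iX A k : regular P A -> regular P (A ^+ k).
  exact: integralX (@regular1 _) (@regularM _) _ _.
case: e => k; first by rewrite -exprnP; apply: iX.
by rewrite NegzE -invr_expz -exprnP -exprVn; apply: iX.
Qed.

Lemma regular_1subqV (e : int) : ~~ (n%:Z %| e)%Z -> regular P (1 - q ^ e)^-1.
Proof.
have nat_case k : ~~ (n %| k)%N -> regular P (1 - q ^+ k)^-1.
  move=> nk; exists 1, (1 - 'X^k); rewrite coprime_1subXn // tofrac1 mul1r.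
  rewrite tofracB tofracXn tofrac1; split=> //.
  rewrite subr_eq0 eq_sym; apply: contra nk => /eqP /(congr1 (fun p : {poly rat} => size p)).
  by rewrite size_polyXn size_poly1 => -[->].
case: e => k; first by rewrite dvdzE -exprnP; apply: nat_case.
rewrite NegzE dvdzE abszN => nk.
have -> : (1 - q ^ (- k.+1%:Z))^-1 = 1 - (1 - q ^+ k.+1)^-1.
  have z1 : 1 - q ^+ k.+1 != 0 by rewrite subr_eq0 eq_sym exprnP q_free.
  by rewrite -invr_expz -exprnP (inv_1subV (expf_neq0 _ q_neq0) z1).
exact: regularB (@regular1 _) (nat_case _ nk).
Qed.
End Units.

Lemma ratfun_half : ((2^-1 : rat)%:P)%:F * 2 = 1 :> ratfun.
Proof.
have -> : (2 : ratfun) = ((2 : rat)%:P)%:F by rewrite polyC_natr rmorph_nat.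
by rewrite -tofracM -polyCM mulVf // polyC1 tofrac1.
Qed.

Lemma ratfun_two_neq0 : (2 : ratfun) != 0.
Proof.
apply/eqP => e; have /eqP := ratfun_half.
by rewrite e mulr0 eq_sym oner_eq0.
Qed.

(** The lower bound on [r] reads d m <= (n - 1) d / 2, that is, 2m <= n - 1. *)
Lemma index_bound (n d m : nat) (r : int) : (0 < n)%N -> (0 < d)%N ->
    n%:R - (n%:R - 1) * d%:R / 2 <= r%:~R :> rat ->
    r = n%:Z - (d * m)%:Z ->
  (2 * m < n)%N.
Proof.
move=> n_gt0 d_gt0 + rE; rewrite {}rE rmorphB /= lerD2l lerN2.
have -> : n%:R - 1 = n.-1%:R :> rat by rewrite -subn1 natrB.
rewrite ler_pdivlMr ?ltr0n // -!natrM ler_nat.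
by nia.
Qed.

Theorem theorem1p3 (n d : nat) (r : int)
    (n_gt1 : (1 < n)%N) (n_odd : odd n) (d_gt0 : (0 < d)%N)
    (co_nd : coprime n d)
    (r_ge : n%:R - (n%:R - 1) * d%:R / 2 <= r%:~R :> rat)
    (r_le : r <= n%:Z)
    (n_eq_r : (n%:Z = r %[mod d%:Z])%Z) :
  eqmod_ratfun (Phi_opp n ^+ 2 * Phi n ^+ 2)
    (\sum_(0 <= k < n) \sum_(0 <= j < k.+1) c d r j * c d r (k - j))
    (qint (q ^+ 2) n%:Z ^+ 2 / qint (q ^+ 2) r ^+ 2
     * q ^ ((2 * (n%:Z - r) * (n%:Z + r - d%:Z)) %/ d%:Z)%Z
     * (\sum_(0 <= k < `|((n%:Z - r) %/ d%:Z)%Z|%N.+1)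
          (qpoch (q ^ (2 * r)) (q ^+ (2 * d)) k * qpoch (q ^ r) (q ^+ (2 * d)) k)
          / (qpoch (q ^+ (2 * d)) (q ^+ (2 * d)) k
             * qpoch (q ^ ((2 * d)%:Z + r)) (q ^+ (2 * d)) k)
          * q ^ (2 * k%:Z * (d%:Z - r))) ^+ 2).
Proof.
have n_gt0 := ltnW n_gt1.
have d0 : d%:Z != 0 by lia.
have [m rE] : exists m, r = n%:Z - (d * m)%:Z.
  have /dvdzP[k kE] : (d%:Z %| n%:Z - r)%Z by rewrite -eqz_mod_dvd; apply/eqP.
  (* The quotient [k] is nonnegative because r <= n, so its absolute value is itself. *)
  by exists `|k|%N; nia.
have m_lt := index_bound n_gt0 d_gt0 r_ge rE.
have -> : ((n%:Z - r) %/ d%:Z)%Z = m%:Z.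
  by rewrite rE opprB addrCA subrr addr0 PoszM mulrC mulzK.
have -> : ((2 * (n%:Z - r) * (n%:Z + r - d%:Z)) %/ d%:Z)%Z
    = 2 * m%:Z * (2 * n%:Z - (d * m)%:Z - d%:Z).
  rewrite -[RHS](mulzK _ d0); congr (_ %/ _)%Z; rewrite rE; ring.
(* It suffices to work modulo (1 - q^(2n))^2, a multiple of the required modulus. *)
rewrite -exprMn; apply: (cong_eqmod (Phi_mul_dvd n_odd n_gt0)).
have -> : (1 - 'X^(2 * n))%:F = 1 - q ^+ (2 * n).
  by rewrite tofracB tofracXn tofrac1.
rewrite rE; apply: double_sum_cong => //.
- exact: regular1.
- exact: regularB.
- exact: regularM.
- exact: q_neq0.
- exact: q_free.
- exact: regular_qexp.
- exact: regular_1subqV.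
- rewrite (_ : 2^-1 = ((2^-1 : rat)%:P)%:F); first exact: regular_poly.
  by apply: (mulIf ratfun_two_neq0); rewrite ratfun_half mulVf ?ratfun_two_neq0.
- exact: ratfun_two_neq0.
Qed.
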